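(* Every graph obtained by the following procedure is a connected unicyclic graph that is not König–Egerváry. Procedure: (1) Construct an odd cycle and color its vertices blue. (2) Either perform step (3), or perform step (4), or stop. (3) Choose any existing vertex $u$, add two new vertices $u_1,u_2$ and edges $uu_1, u_1u_2$; color $u_1$ red and $u_2$ black; go to (2). (4) If there is no red vertex go to (2); otherwise choose a red vertex $u$, add a new vertex $u_1$ and the edge $uu_1$, color $u_1$ black; go to (2).
   Context: All graphs are finite and simple. $\alpha(G)$ is the maximum size of an independent set and $\mu(G)$ the maximum size of a matching. $G$ is König–Egerváry if $\alpha(G)+\mu(G)=|V(G)|$. A graph is unicyclic if it contains exactly one cycle. *)

(* Defs.v *)
From mathcomp Require Import all_boot.

Set Implicit Arguments.
Unset Strict Implicit.
Unset Printing Implicit Defensive.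

Record sgraph := SGraph {
  vertex :> finType;
  adj : rel vertex;
  adj_sym : symmetric adj;
  adj_irrefl : irreflexive adj }.

Definition isomorphic (G H : sgraph) : Prop :=
  exists f : G -> H, bijective f /\ forall x y, adj (f x) (f y) = adj x y.

Definition independent (G : sgraph) (A : {set G}) : bool :=
  [forall x in A, forall y in A, ~~ adj x y].

Definition alpha (G : sgraph) : nat := \max_(A : {set G} | independent A) #|A|.

Definition edges (G : sgraph) : {set {set G}} :=
  [set e : {set G} | [exists x, exists y, adj x y && (e == [set x; y])]].

Definition matching (G : sgraph) (M : {set {set G}}) : bool :=
  (M \subset edges G) && trivIset M.

Definition mu (G : sgraph) : nat := \max_(M : {set {set G}} | matching M) #|M|.

Definition konig_egervary (G : sgraph) : Prop := alpha G + mu G = #|G|.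

Definition connected (G : sgraph) : Prop :=
  0 < #|G| /\ forall x y : G, connect (@adj G) x y.

(* A cycle is a subgraph, not a cyclic sequence: rotating or reversing the
   sequence [s] below does not change the cycle. Since a cycle is determined by
   its edges, it is represented by its edge set. *)
Definition cycle_edges (G : sgraph) (s : seq G) : {set {set G}} :=
  [set [set x; next s x] | x in s].

Definition is_cycle (G : sgraph) (C : {set {set G}}) : Prop :=
  exists s : seq G, [/\ 2 < size s, ucycle (@adj G) s & C = cycle_edges s].

Definition unicyclic (G : sgraph) : Prop :=
  exists! C : {set {set G}}, is_cycle C.

Section CycleGraph.
Variable n : nat.

(* The guard [i != j] only matters for the degenerate case n = 1. *)
Definition cycle_adj (i j : 'I_n) : bool :=
  (i != j) && ((ordS i == j) || (ordS j == i)).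

Lemma cycle_adj_sym : symmetric cycle_adj.
Proof. by move=> i j; rewrite /cycle_adj eq_sym orbC. Qed.

Lemma cycle_adj_irrefl : irreflexive cycle_adj.
Proof. by move=> i; rewrite /cycle_adj eqxx. Qed.

Definition cycle_graph : sgraph := SGraph cycle_adj_sym cycle_adj_irrefl.

End CycleGraph.

Section Pendant.
Variables (G : sgraph) (u : G).

Definition pendant_adj (x y : option G) : bool :=
  match x, y with
  | Some x', Some y' => adj x' y'
  | Some x', None => x' == u
  | None, Some y' => y' == u
  | None, None => false
  end.

Lemma pendant_adj_sym : symmetric pendant_adj.
Proof. by case=> [x|] [y|] //=; rewrite adj_sym. Qed.

Lemma pendant_adj_irrefl : irreflexive pendant_adj.
Proof. by case=> [x|] //=; rewrite adj_irrefl. Qed.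

(* [G] with a new vertex [None] joined to [u] only. *)
Definition pendant : sgraph := SGraph pendant_adj_sym pendant_adj_irrefl.

End Pendant.

Inductive color := Blue | Red | Black.

Definition pendant_color (G : sgraph) (u : G) (c : G -> color) (k : color) :
    pendant u -> color :=
  fun x => if x is Some y then c y else k.

Inductive construction : forall G : sgraph, (G -> color) -> Prop :=
| construct_odd_cycle (n : nat) :
    2 < n -> odd n -> @construction (cycle_graph n) (fun=> Blue)
| construct_path (G : sgraph) (c : G -> color) (u : G) :
    construction c ->
    let u1 : pendant u := None in
    construction (pendant_color (u := u1) (pendant_color (u := u) c Red) Black)
| construct_leaf (G : sgraph) (c : G -> color) (u : G) :
    construction c -> c u = Red ->
    construction (pendant_color (u := u) c Black).

(* [construction] fixes the names of the vertices, hence the isomorphism. *)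
Definition obtained_by_procedure (G : sgraph) : Prop :=
  exists (H : sgraph) (c : H -> color), construction c /\ isomorphic H G.

(* Main.v *)
Require Import Defs.
From mathcomp Require Import all_boot zify.

Set Implicit Arguments.
Unset Strict Implicit.
Unset Printing Implicit Defensive.

(* Every edge has a red end or two blue ends, so a matching has at most
   |Red| + |Blue|/2 edges. An independent set has at most |Blue|/2 + |Black|
   vertices, because it contains at most half of the cycle and every red vertex
   comes with its own black neighbour. Since |Blue| is odd, these two bounds add
   up to |V| - 1. A pendant vertex lies on no cycle, so the original cycle
   remains the only one. *)

(** * Counting in disjoint families and after adding a vertex *)

(** Disjoint blocks count each element of [R] at most once. Used with [M] a matching and [R] a color
    class. *)
Lemma big_trivIset_card (T : finType) (M : {set {set T}}) (R : {set T}) :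
  trivIset M -> \sum_(e in M) #|e :&: R| <= #|R|.
Proof.
move=> tM; have cardIE e : #|e :&: R| = \sum_(x in e) (x \in R).
  rewrite -sum1_card [RHS]big_mkcond [LHS]big_mkcond /=.
  by apply: eq_bigr => x _; rewrite inE; case: (x \in e); case: (x \in R).
under eq_bigr do rewrite cardIE.
rewrite -(@big_trivIset _ _ _ addn M (fun x => x \in R : nat) tM) -sum1_card.
rewrite [leqRHS]big_mkcond [leqLHS]big_mkcond /=.
by apply: leq_sum => x _; case: (x \in R); case: ifP.
Qed.

Lemma card_pred_option (T : finType) (P : pred (option T)) :
  #|P| = P None + #|[pred x | P (Some x)]|.
Proof.
rewrite (cardD1 None); congr addn.
rewrite -[RHS](card_image (@Some_inj _)); apply: eq_card => -[x|]; rewrite !inE /=.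
  by rewrite (mem_image (@Some_inj _)).
by apply/esym/negbTE/negP => /imageP[].
Qed.

(** * Colorings and the bounds they give on [alpha] and [mu] *)

Definition is_blue (k : color) := if k is Blue then true else false.
Definition is_red (k : color) := if k is Red then true else false.
Definition is_black (k : color) := if k is Black then true else false.

Definition color_count (T : finType) (c : T -> color) (p : pred color) : nat :=
  #|[pred x | p (c x)]|.

Lemma card_colors (T : finType) (c : T -> color) :
  #|T| = color_count c is_blue + color_count c is_red + color_count c is_black.
Proof.
have countE p : color_count c p = \sum_x p (c x).
  by rewrite /color_count -sum1_card big_mkcond; apply: eq_bigr => x _; rewrite inE; case: (p _).
rewrite -sum1_card !countE -!big_split /=.
by apply: eq_bigr => x _; case: (c x).
Qed.

Lemma color_count_pendant (G : sgraph) (u : G) (c : G -> color) k p :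
  color_count (pendant_color (u := u) c k) p = p k + color_count c p.
Proof. exact: card_pred_option. Qed.

(** The invariant of the procedure. The last clause carries the numerical bound itself through the
    induction, so no pairing of red with black vertices has to be recorded. *)
Definition good_coloring (G : sgraph) (c : G -> color) : Prop :=
  [/\ forall x y : G, adj x y ->
        [|| is_red (c x), is_red (c y) | is_blue (c x) && is_blue (c y)],
      odd (color_count c is_blue) &
      forall A : {set G}, independent A ->
        #|A| <= (color_count c is_blue)./2 + color_count c is_black].

Lemma good_coloring_alpha (G : sgraph) (c : G -> color) :
  good_coloring c -> alpha G <= (color_count c is_blue)./2 + color_count c is_black.
Proof. by case=> _ _ indA; apply/bigmax_leqP. Qed.

(** Give blue ends weight 1 and red ends weight 2. Every edge then weighs at least 2, while
    disjointness bounds the total weight of a matching by the number of blue vertices plus twice the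
    number of red ones. *)
Lemma good_coloring_mu (G : sgraph) (c : G -> color) :
  good_coloring c -> mu G <= (color_count c is_blue)./2 + color_count c is_red.
Proof.
case=> edge_c _ _; apply/bigmax_leqP => M /andP[/subsetP sME tM].
pose B := [set x | is_blue (c x)]; pose R := [set x | is_red (c x)].
have cB : #|B| = color_count c is_blue by apply: eq_card => x; rewrite !inE.
have cR : #|R| = color_count c is_red by apply: eq_card => x; rewrite !inE.
have : \sum_(e in M) 2 <= \sum_(e in M) (#|e :&: B| + 2 * #|e :&: R|).
  apply: leq_sum => e /sME; rewrite inE => /existsP[x /existsP[y /andP[xy /eqP->]]].
  have nxy : x != y by apply: contraTneq xy => ->; rewrite adj_irrefl.
  case/or3P: (edge_c _ _ xy) => [rx|ry|/andP[bx b_y]].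
  - have : 0 < #|[set x; y] :&: R| by apply/card_gt0P; exists x; rewrite !inE eqxx rx.
    lia.
  - have : 0 < #|[set x; y] :&: R|.
      by apply/card_gt0P; exists y; rewrite !inE eqxx orbT ry.
    lia.
  (* Both ends are blue, so the edge lies inside [B] and meets it in exactly 2 vertices. *)
  - rewrite (setIidPl _) ?cards2 ?nxy ?leq_addr //.
    by apply/subsetP=> z; rewrite !inE => /orP[]/eqP->.
rewrite sum_nat_const big_split -big_distrr /=.
have := big_trivIset_card B tM; have := big_trivIset_card R tM.
rewrite cB cR; move: (\sum_(e in M) #|e :&: R|) (\sum_(e in M) #|e :&: B|) #|M|; lia.
Qed.

Lemma good_coloring_not_konig_egervary (G : sgraph) (c : G -> color) :
  good_coloring c -> ~ konig_egervary G.
Proof.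
move=> gc; have := good_coloring_alpha gc; have := good_coloring_mu gc.
have [_ oddB _] := gc; rewrite /konig_egervary (card_colors c); lia.
Qed.

(** * The cyclic successor and the coloring of the odd cycle *)

Lemma iter_ordS n (i : 'I_n) k : iter k (@ordS n) i = (i + k) %% n :> nat.
Proof.
elim: k => [|k IHk]; first by rewrite addn0 modn_small.
by rewrite iterS /= IHk -addn1 modnDml addn1 addnS.
Qed.

Lemma iter_ordS_onto n (i j : 'I_n) : exists k, j = iter k (@ordS n) i.
Proof.
(* Going [n - i] steps from [i] wraps around to 0; [j] more steps reach [j]. *)
exists (n - i + j); apply: val_inj; rewrite /= iter_ordS addnA subnKC 1?ltnW //.
by rewrite modnDl modn_small.
Qed.

Lemma iter_ordS_neq n (i : 'I_n) k : 0 < k < n -> iter k (@ordS n) i != i.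
Proof.
move=> /andP[k_gt0 ltkn]; apply/negP => /eqP/(congr1 val); rewrite /= iter_ordS.
(* Since [i + k < 2n], reduction modulo [n] subtracts [n] at most once. *)
have ltin := ltn_ord i; have [lt_ikn|le_nik] := ltnP (i + k) n.
  by rewrite modn_small //; lia.
by rewrite -(subnK le_nik) modnDr modn_small; lia.
Qed.

Lemma cycle_adj_ordS n (i : 'I_n) : 1 < n -> cycle_adj i (ordS i).
Proof.
by move=> n_gt1; rewrite /cycle_adj eqxx andbT eq_sym (@iter_ordS_neq n i 1).
Qed.

(** An independent set is disjoint from its shift by [ordS], which has the same size; hence twice
    its size is at most [n]. *)
Lemma good_coloring_cycle n :
  1 < n -> odd n -> good_coloring (fun _ : cycle_graph n => Blue).
Proof.
have cb : color_count (fun _ : cycle_graph n => Blue) is_blue = n.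
  by rewrite -[RHS]card_ord; apply: eq_card.
move=> n_gt1 odd_n; split; rewrite ?cb // => A indA.
have dAS : [disjoint A & [set ordS x | x in A]].
  apply/pred0P => y; apply/negbTE/negP => /andP[/= Ay /imsetP[x Ax yx]].
  have /forall_inP/(_ x Ax)/forall_inP/(_ y Ay)/negP[] := indA.
  by rewrite yx; apply: cycle_adj_ordS.
have := max_card (mem (A :|: [set ordS x | x in A])).
rewrite cardsU (disjoint_setI0 dAS) cards0 subn0.
rewrite (card_imset _ (@ordS_inj n)) card_ord addnn => leAn.
by apply: leq_trans (leq_addr _ _); rewrite geq_half_double.
Qed.

(** * Preservation of good colorings by the procedure and by isomorphism *)

Lemma independent_preimset (G H : sgraph) (h : G -> H) (A : {set H}) :
  (forall x y, adj (h x) (h y) = adj x y) -> independent A -> independent (h @^-1: A).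
Proof.
move=> adjh /forall_inP indA; apply/forall_inP => x; rewrite inE => Ax.
by apply/forall_inP => y; rewrite inE -adjh; have /forall_inP := indA _ Ax; apply.
Qed.

(** Both new edges end in the red vertex [Some None]. An independent set contains at most one of the
    two new vertices, and the new black vertex raises the bound by one. *)
Lemma good_coloring_path (G : sgraph) (c : G -> color) (u : G) :
  good_coloring c ->
  good_coloring (pendant_color (u := None : pendant u)
                   (pendant_color (u := u) c Red) Black).
Proof.
move=> [edge_c oddB indA]; split; rewrite ?color_count_pendant //=.
- by move=> [[x|]|] [[y|]|] //=; rewrite ?orbT //; apply: edge_c.
move=> A indepA.
pose A1 : {set pendant u} := Some @^-1: A; pose A0 : {set G} := Some @^-1: A1.
have leA0 : #|A0| <= (color_count c is_blue)./2 + color_count c is_black.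
  apply: indA; apply: (independent_preimset (H := pendant u)) => //.
  exact: independent_preimset indepA.
have -> : #|A| = (None \in A) + ((Some None \in A) + #|A0|).
  rewrite card_pred_option; congr addn; rewrite card_pred_option; congr addn.
  by apply: eq_card => x; rewrite !inE.
have : ~~ ((None \in A) && (Some None \in A)).
  apply/negP => /andP[A_2 A_1].
  by have /forall_inP/(_ _ A_2)/forall_inP/(_ _ A_1) := indepA.
by case: (None \in A); case: (Some None \in A) => //= _; lia.
Qed.

(** The only new edge has the red end [u], and the new vertex, being black, pays for itself in the
    bound. *)
Lemma good_coloring_leaf (G : sgraph) (c : G -> color) (u : G) :
  good_coloring c -> c u = Red -> good_coloring (pendant_color (u := u) c Black).
Proof.
move=> [edge_c oddB indA] cu; split; rewrite ?color_count_pendant //=.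
- move=> [x|] [y|] //=; first exact: edge_c.
    by move=> /eqP->; rewrite cu.
  by move=> /eqP->; rewrite cu.
move=> A indepA; pose A0 : {set G} := Some @^-1: A.
have leA0 : #|A0| <= (color_count c is_blue)./2 + color_count c is_black.
  by apply: indA; apply: independent_preimset indepA.
have -> : #|A| = (None \in A) + #|A0|.
  by rewrite card_pred_option; congr addn; apply: eq_card => x; rewrite !inE.
by case: (None \in A) => /=; lia.
Qed.

Lemma construction_good_coloring (G : sgraph) (c : G -> color) :
  construction c -> good_coloring c.
Proof.
elim=> {G c} [n n_gt2 odd_n|G c u _ gc|G c u _ gc cu].
- by apply: good_coloring_cycle => //; apply: ltnW.
- exact: good_coloring_path.
- exact: good_coloring_leaf.
Qed.

Lemma good_coloring_isomorphic (G H : sgraph) (c : G -> color) :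
  isomorphic G H -> good_coloring c -> exists d : H -> color, good_coloring d.
Proof.
move=> [f [[g fK gK] adjf]] [edge_c oddB indA]; exists (c \o g).
have adjg x y : adj (g x) (g y) = adj x y by rewrite -adjf !gK.
have g_inj := can_inj gK.
have ccg p : color_count (c \o g) p = color_count c p.
  rewrite /color_count -(card_image g_inj); apply: eq_card => x.
  by rewrite -[x]fK (mem_image g_inj) !inE.
split; rewrite ?ccg //; first by move=> x y; rewrite -adjg; apply: edge_c.
move=> A indepA; rewrite -(on_card_preimset (f := f)).
  exact/indA/independent_preimset.
by exists g => x _.
Qed.

(** * Connectedness *)

Lemma connect_homo (G H : sgraph) (h : G -> H) (x y : G) :
  (forall x y, adj (h x) (h y) = adj x y) ->
  connect (@adj G) x y -> connect (@adj H) (h x) (h y).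
Proof.
move=> adjh /connectP[p xp ->]; apply/connectP; exists (map h p).
  by rewrite (@map_path _ _ h (@adj H) (@adj G) pred0) // ?has_pred0 // => ? ?.
by rewrite last_map.
Qed.

Lemma connected_isomorphic (G H : sgraph) :
  isomorphic G H -> connected G -> connected H.
Proof.
move=> [f [[g fK gK] adjf]] [G0 connG]; split.
  by have /card_gt0P[x _] := G0; apply/card_gt0P; exists (f x).
by move=> x y; rewrite -[x]gK -[y]gK; apply: connect_homo.
Qed.

Lemma connected_pendant (G : sgraph) (u : G) : connected G -> connected (pendant u).
Proof.
move=> [_ connG]; split; first by apply/card_gt0P; exists None.
(* The attachment vertex serves as a hub; symmetry of [adj] then joins any two vertices through
   it. *)
have conn_u x : connect (@adj (pendant u)) x (Some u).
  case: x => [x|]; last by apply: connect1 => /=.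
  exact: (connect_homo (h := Some : G -> pendant u)).
move=> x y; apply: connect_trans (conn_u x) _.
by rewrite (sym_connect_sym (@adj_sym _)).
Qed.

Lemma connected_cycle n : 1 < n -> connected (cycle_graph n).
Proof.
move=> n_gt1; split; first by rewrite card_ord ltnW.
move=> i j; have [k ->] := iter_ordS_onto i j.
elim: k => //= k /connect_trans; apply; apply: connect1.
exact: cycle_adj_ordS.
Qed.

(** * Uniqueness of the cycle *)

(** If the two coincided, two steps of [next] would return to [x]; but after rotating [s] to
    [x :: y :: z :: s'], two steps lead to [z]. This provides two distinct neighbours for every
    vertex of a cycle. *)
Lemma next_neq_prev (T : eqType) (s : seq T) (x : T) :
  uniq s -> 2 < size s -> x \in s -> next s x != prev s x.
Proof.
move=> us s_gt2 /rot_to[i s' def_s']; apply/negP => /eqP nextE.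
have := prev_next us; move: (next_prev us x); rewrite -nextE -!(next_rot i us).
move: us s_gt2; rewrite -(rot_uniq i) -(size_rot i) def_s'.
case: s' {def_s'} => [|y [|z s']] //=; rewrite !inE !negb_or eqxx.
move=> /andP[/and3P[/negbTE xy /negbTE xz _] _] _.
by rewrite eqxx eq_sym xy => /eqP; rewrite eq_sym xz.
Qed.

Lemma cycle_edges_map (G H : sgraph) (h : G -> H) (s : seq G) :
  injective h -> uniq s ->
  cycle_edges (map h s) = [set h @: (e : {set G}) | e in cycle_edges s].
Proof.
move=> h_inj us; apply/setP => E; apply/imsetP/imsetP.
  move=> [_ /mapP[x sx ->] ->]; exists [set x; next s x]; first exact: imset_f.
  by rewrite next_map // imsetU1 imset_set1.
move=> [_ /imsetP[x sx ->] ->]; exists (h x); first by rewrite mem_map.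
by rewrite next_map // imsetU1 imset_set1.
Qed.

(** When every cycle of [H] lifts along an induced embedding, the unique cycle of [H] is the image
    of that of [G]. This serves both isomorphisms and pendant vertices. *)
Lemma unicyclic_embedding (G H : sgraph) (h : G -> H) :
  injective h -> (forall x y, adj (h x) (h y) = adj x y) ->
  (forall s, 2 < size s -> ucycle (@adj H) s -> exists t, s = map h t) ->
  unicyclic G -> unicyclic H.
Proof.
move=> h_inj adjh cycle_h [C [[s [s_gt2 cs defC]] uniqC]].
have map_ucycle t : ucycle (@adj H) (map h t) = ucycle (@adj G) t.
  by rewrite /ucycle map_inj_uniq // cycle_map (eq_cycle (e' := @adj G)).
exists [set h @: (e : {set G}) | e in C]; split.
  exists (map h s); rewrite size_map map_ucycle; split=> //.
  by rewrite defC cycle_edges_map //; case/andP: cs.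
move=> _ [t' [t_gt2 ct ->]]; have [t def_t] := cycle_h _ t_gt2 ct.
move: t_gt2 ct; rewrite def_t size_map map_ucycle => t_gt2 ct.
rewrite cycle_edges_map //; last by case/andP: ct.
by rewrite (uniqC (cycle_edges t)) //; exists t.
Qed.

Lemma unicyclic_isomorphic (G H : sgraph) :
  isomorphic G H -> unicyclic G -> unicyclic H.
Proof.
move=> [f [[g fK gK] adjf]]; apply: (unicyclic_embedding (can_inj fK) adjf) => s _ _.
by exists (map g s); rewrite (mapK gK).
Qed.

Lemma unicyclic_pendant (G : sgraph) (u : G) : unicyclic G -> unicyclic (pendant u).
Proof.
apply: (unicyclic_embedding (h := Some : G -> pendant u)) => //; first exact: Some_inj.
move=> s s_gt2 /andP[cs us].
have : None \notin s.
  (* Both cyclic neighbours of [None] would have to be [Some u], yet they are distinct. *)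
  apply/negP => s0; have /negP[] := next_neq_prev us s_gt2 s0.
  have := next_cycle cs s0; have := prev_cycle cs s0.
  by case: next prev => [x|] [y|] //= /eqP-> /eqP->.
elim: s {s_gt2 cs us} => [|[x|] s IHs] //=; first by exists [::].
by rewrite inE /= => /IHs[t ->]; exists (x :: t).
Qed.

(** The vertices of a cycle are closed under [ordS], hence are all of ['I_n], and each edge from [i]
    to [ordS i] is traversed in one direction or the other. *)
Lemma ucycle_cycle_graph n (s : seq (cycle_graph n)) :
  2 < size s -> ucycle (@adj (cycle_graph n)) s ->
  cycle_edges s = [set [set i; ordS i] | i : 'I_n].
Proof.
move=> s_gt2 /andP[cs us].
(* [next s i] and [prev s i] are distinct and [ordS] is injective, so one of
   them is the successor of [i] on the graph. *)
have succ_s i : i \in s -> next s i = ordS i \/ prev s i = ordS i.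
  move=> si; have := next_neq_prev us s_gt2 si.
  have := next_cycle cs si; have := prev_cycle cs si; rewrite /= /cycle_adj.
  move=> /andP[_ /orP[]/eqP prevE]; last by right.
  move=> /andP[_ /orP[]/eqP nextE]; first by left.
  by case/eqP; apply: (@ordS_inj n); rewrite nextE prevE.
have s_all i : i \in s.
  case: s s_gt2 succ_s {cs us} => // i0 s _ succ_s.
  have [k ->] := iter_ordS_onto i0 i.
  elim: k => [|k IHk]; first exact: mem_head.
  by rewrite iterS; have [<-|<-] := succ_s _ IHk; rewrite ?mem_next ?mem_prev.
apply/setP => e; apply/imsetP/imsetP => -[i _ ->].
  have := next_cycle cs (s_all i); rewrite /= /cycle_adj.
  move=> /andP[_ /orP[]/eqP nextE]; first by exists i; rewrite ?nextE.
  by exists (next s i); rewrite // nextE setUC.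
have [nextE|prevE] := succ_s i (s_all i); first by exists i; rewrite ?nextE.
(* Here [s] runs against [ordS], so the edge is indexed by its other end. *)
by exists (prev s i); rewrite ?mem_prev // next_prev // prevE setUC.
Qed.

Lemma unicyclic_cycle n : 2 < n -> unicyclic (cycle_graph n).
Proof.
move=> n_gt2; exists [set [set i; ordS i] | i : 'I_n]; split; last first.
  by move=> _ [s [s_gt2 cs ->]]; rewrite ucycle_cycle_graph.
have i0 : 'I_n := Ordinal (ltnW (ltnW n_gt2)); pose s := orbit (@ordS n) i0.
have s_gt2 : 2 < size s.
  (* As [n > 2], the first three points of the orbit are distinct, so the orbit is long enough to be
     a cycle. *)
  have /uniq_leq_size : uniq [:: i0; ordS i0; ordS (ordS i0)].
    have neq1 : ordS i0 != i0 by apply: (@iter_ordS_neq n i0 1); apply: ltnW.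
    have neq2 : ordS (ordS i0) != i0 by apply: (@iter_ordS_neq n i0 2).
    rewrite cons_uniq /= !inE negb_or !(eq_sym i0) neq1 neq2.
    by rewrite (inj_eq (@ordS_inj n)) eq_sym neq1.
  apply=> i; rewrite -fconnect_orbit !inE => /or3P[]/eqP->.
  - exact: connect0.
  - exact: fconnect1.
  - exact: (fconnect_iter _ 2).
have cs : ucycle (@adj (cycle_graph n)) s.
  rewrite /ucycle orbit_uniq andbT.
  apply: sub_cycle (cycle_orbit (@ordS_inj n) i0) => i j /eqP<-.
  by apply: cycle_adj_ordS; apply: ltnW.
by exists s; rewrite ucycle_cycle_graph.
Qed.

(** * Induction on the construction and transfer along the isomorphism *)

Lemma construction_connected_unicyclic (G : sgraph) (c : G -> color) :
  construction c -> connected G /\ unicyclic G.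
Proof.
elim=> {G c} [n n_gt2 _|G c u _ [connG uniG]|G c u _ [connG uniG] _].
- by split; [apply: connected_cycle; apply: ltnW | apply: unicyclic_cycle].
- by split; [do 2!apply: connected_pendant | do 2!apply: unicyclic_pendant].
- by split; [apply: connected_pendant | apply: unicyclic_pendant].
Qed.

Theorem theorem4p6 (G : sgraph) (hG : obtained_by_procedure G) :
  [/\ connected G, unicyclic G & ~ konig_egervary G].
Proof.
have [H [c [cH isoHG]]] := hG.
have [connH uniH] := construction_connected_unicyclic cH.
have [d gd] := good_coloring_isomorphic isoHG (construction_good_coloring cH).
split; [exact: connected_isomorphic connH | exact: unicyclic_isomorphic uniH |].
exact: good_coloring_not_konig_egervary gd.
Qed.
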